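(* Let $(T^*Q,G,\omega,H,F,W)$ be a regular orbit reducible RCH system with an $R_o$-reduced RCH system $((T^*Q)_{\mathcal O_\mu},\omega_{\mathcal O_\mu},h_{\mathcal O_\mu},f_{\mathcal O_\mu},u_{\mathcal O_\mu})$, where $\mu\in\mathfrak g^*$ is a regular value of the momentum map $\mathbf J$ and $\mathcal O_\mu$ is the regular reducible orbit of the corresponding Hamiltonian system $(T^*Q,G,\omega,H)$. Let $\tilde X=X_{(T^*Q,G,\omega,H,F,u)}$ be the dynamical vector field of $(T^*Q,G,\omega,H,F,W)$ with a control law $u$. Let $\gamma:Q\to T^*Q$ be a one-form on $Q$, $\lambda=\gamma\circ\pi_Q:T^*Q\to T^*Q$, and for any $G$-invariant symplectic map $\varepsilon:T^*Q\to T^*Q$ denote $\tilde X^\varepsilon=T\pi_Q\circ\tilde X\circ\varepsilon$. Assume that $\mathrm{Im}(\gamma)\subset\mathbf J^{-1}(\mu)$ and $\gamma$ is $G$-invariant, and that $\varepsilon(\mathbf J^{-1}(\mathcal O_\mu))\subset\mathbf J^{-1}(\mathcal O_\mu)$. Denote $\bar\gamma=\pi_{\mathcal O_\mu}\circ\gamma:Q\to(T^*Q)_{\mathcal O_\mu}$, $\bar\lambda=\pi_{\mathcal O_\mu}\circ\lambda:\mathbf J^{-1}(\mathcal O_\mu)\to(T^*Q)_{\mathcal O_\mu}$ and $\bar\varepsilon=\pi_{\mathcal O_\mu}\circ\varepsilon:\mathbf J^{-1}(\mathcal O_\mu)\to(T^*Q)_{\mathcal O_\mu}$. Then $\varepsilon$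 and $\bar\varepsilon$ satisfy the equation $$T\bar\varepsilon\circ X_{h_{\mathcal O_\mu}\circ\bar\varepsilon}=T\bar\lambda\circ\tilde X\circ\varepsilon$$ if and only if they satisfy the equation $$T\bar\gamma\circ\tilde X^\varepsilon=X_{h_{\mathcal O_\mu}}\circ\bar\varepsilon ,$$ where $X_{h_{\mathcal O_\mu}}$ and $X_{h_{\mathcal O_\mu}\circ\bar\varepsilon}$ are the Hamiltonian vector fields of $h_{\mathcal O_\mu}$ and $h_{\mathcal O_\mu}\circ\bar\varepsilon$, respectively. (The latter equation is called the Type II of Hamilton-Jacobi equation for the $R_o$-reduced RCH system.)
   Context: All manifolds and maps are smooth and finite dimensional. $\pi_Q:T^*Q\to Q$ is the projection, $\omega=-\mathbf d\theta$ the canonical symplectic form on $T^*Q$; Hamiltonian vector fields are defined by $\mathbf i_{X_K}\omega=\mathbf dK$. A one-form is a section $\gamma:Q\to T^*Q$. RCH systems: on a symplectic fiber bundle $(E,\omega_E)$, $\pi:E\to M$, an RCH system is a 5-tuple $(E,\omega_E,H,F,W)$ with $H:E\to\mathbb R$, $F:E\to E$ fiber-preserving (external force), $W\subset E$ a fiber submanifold (control subset); a control law is a fiber-preserving $u:E\to W$. Fix a metric on $E$ giving $TE=HE\oplus VE$, $VE=\ker T\pi$. $\mathrm{vlift}(F)X_H(a_x)$, $a_x\in E_x$, is the vertical part of $TF(X_H(a_x))$ (a vector at $F(a_x)$), parallel-translated to $a_x$ along a geodesic in $E_x$ from $F(a_x)$ to $a_x$ (a straight line if the fibers are vector spaces);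 one writes $\mathrm{vlift}(F)$ for $\mathrm{vlift}(F)X_H$, likewise $\mathrm{vlift}(u)$. The dynamical vector field is $X_H+\mathrm{vlift}(F)+\mathrm{vlift}(u)$. Orbit reduction: a Lie group $G$ with Lie algebra $\mathfrak g$ acts on $Q$ on the left; the cotangent lifted action $\Phi^{T^*}$ on $T^*Q$ is symplectic, free and proper and has an $\mathrm{Ad}^*$-equivariant momentum map $\mathbf J:T^*Q\to\mathfrak g^*$. For a regular value $\mu$, $\mathcal O_\mu=G\cdot\mu\subset\mathfrak g^*$ is the coadjoint orbit, $(T^*Q)_{\mathcal O_\mu}=\mathbf J^{-1}(\mathcal O_\mu)/G$, $i_{\mathcal O_\mu}:\mathbf J^{-1}(\mathcal O_\mu)\to T^*Q$ the injection, $\pi_{\mathcal O_\mu}:\mathbf J^{-1}(\mathcal O_\mu)\to(T^*Q)_{\mathcal O_\mu}$ the projection, $\mathbf J_{\mathcal O_\mu}=\mathbf J\circ i_{\mathcal O_\mu}$, and the symplectic form $\omega_{\mathcal O_\mu}$ is determined by $i_{\mathcal O_\mu}^*\omega=\pi_{\mathcal O_\mu}^*\omega_{\mathcal O_\mu}+\mathbf J_{\mathcal O_\mu}^*\omega^+_{\mathcal O_\mu}$, where $\omega^+_{\mathcal O_\mu}(\nu)(\xi_{\mathfrak g^*}(\nu),\eta_{\mathfrak g^*}(\nu))=\langle\nu,[\xi,\eta]\rangle$ for $\nu\in\mathcal O_\mu$, $\xi,\eta\in\mathfrak g$. A regular orbit reducible RCH system is a 6-tuple $(T^*Q,G,\omega,H,F,W)$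 with $H,F,W$ all $G$-invariant (for maps, invariant means commuting with the action) such that for some orbit $\mathcal O_\mu$ with $\mu$ a regular value of $\mathbf J$ one has $F(\mathbf J^{-1}(\mathcal O_\mu))\subset\mathbf J^{-1}(\mathcal O_\mu)$, $W\cap\mathbf J^{-1}(\mathcal O_\mu)\neq\emptyset$, and the $R_o$-reduced 5-tuple $((T^*Q)_{\mathcal O_\mu},\omega_{\mathcal O_\mu},h_{\mathcal O_\mu},f_{\mathcal O_\mu},W_{\mathcal O_\mu})$ is an RCH system, where $h_{\mathcal O_\mu}\circ\pi_{\mathcal O_\mu}=H\circ i_{\mathcal O_\mu}$, $f_{\mathcal O_\mu}\circ\pi_{\mathcal O_\mu}=\pi_{\mathcal O_\mu}\circ F\circ i_{\mathcal O_\mu}$, $W_{\mathcal O_\mu}=\pi_{\mathcal O_\mu}(W\cap\mathbf J^{-1}(\mathcal O_\mu))$. The dynamical vector field with control law $u$ is $X_{(T^*Q,G,\omega,H,F,u)}=X_H+\mathrm{vlift}(F)+\mathrm{vlift}(u)$; a reduced control law $u_{\mathcal O_\mu}:(T^*Q)_{\mathcal O_\mu}\to W_{\mathcal O_\mu}$ gives the reduced dynamical vector field $X_{h_{\mathcal O_\mu}}+\mathrm{vlift}(f_{\mathcal O_\mu})+\mathrm{vlift}(u_{\mathcal O_\mu})$, assumed to satisfy $(X_{h_{\mathcal O_\mu}}+\mathrm{vlift}(f_{\mathcal O_\mu})+\mathrm{vlift}(u_{\mathcal O_\mu}))\circ\pi_{\mathcal O_\mu}=T\pi_{\mathcal O_\mu}\circ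 X_{(T^*Q,G,\omega,H,F,u)}\circ i_{\mathcal O_\mu}$. A one-form $\gamma$ is $G$-invariant if $\gamma(g\cdot q)=\Phi^{T^*}_g(\gamma(q))$, and $\varepsilon$ is $G$-invariant if $\varepsilon\circ\Phi^{T^*}_g=\Phi^{T^*}_g\circ\varepsilon$, for all $g\in G$. The function $h_{\mathcal O_\mu}\circ\bar\varepsilon$ on $\mathbf J^{-1}(\mathcal O_\mu)$ equals $(H\circ\varepsilon)|_{\mathbf J^{-1}(\mathcal O_\mu)}$ and is regarded as a function on $T^*Q$ through its extension $H\circ\varepsilon$, so $X_{h_{\mathcal O_\mu}\circ\bar\varepsilon}$ is the Hamiltonian vector field of $H\circ\varepsilon$ with respect to $\omega$, taken along $\mathbf J^{-1}(\mathcal O_\mu)$. The two equations are equations of maps on $\mathbf J^{-1}(\mathcal O_\mu)$. *)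

(* Defs.v *)
From HB Require Import structures.
From mathcomp Require Import all_boot all_order all_algebra.
From mathcomp Require Import mathcomp_extra boolp classical_sets functions.
From mathcomp Require Import reals topology normedtype derive.

Set Implicit Arguments.
Unset Strict Implicit.
Unset Printing Implicit Defensive.
Import Order.TTheory GRing.Theory Num.Theory.
Import numFieldNormedType.Exports.
Local Open Scope classical_set_scope.
Local Open Scope ring_scope.

Fixpoint Ck (R : realType) (U V : normedModType R) (k : nat) (A : set U)
    (f : U -> V) : Prop :=
  match k with
  | 0 => forall x, A x -> {for x, continuous f}
  | k'.+1 => (forall x, A x -> differentiable f x) /\
             (forall v, Ck k' A (fun x => 'D_v f x))
  end.

Definition smooth_on (R : realType) (U V : normedModType R) (A : set U)
  (f : U -> V) : Prop := forall k, Ck k A f.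

Definition smooth_near (R : realType) (U V : normedModType R) (x : U)
  (f : U -> V) : Prop := exists A, [/\ open A, A x & smooth_on A f].

(* A chart is given by its domain, its coordinate map, and a total function
   that inverts the coordinate map on the image of the domain; only the values
   of [cmap] on [cdom] and of [cinv] on that image are meaningful.

   [premanifold] carries the data of an atlas, [is_manifold] the axioms.
   The atlas comes with a choice [chart_at p] of a chart around each point.
   This choice identifies every T_p M with 'rV_(mdim M): the row vector [v]
   stands for the tangent vector at [p] having coordinates [v] in the chart
   [chart_at p].  Accordingly the total space TM is M * 'rV_(mdim M), and
   elements of T*_p M are row vectors of coordinates in the dual basis. *)

Record chart (R : realType) (n : nat) (M : Type) := Chart {
  cdom : set M;
  cmap : M -> 'rV[R]_n;
  cinv : 'rV[R]_n -> M }.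

Record premanifold (R : realType) := Premanifold {
  carrier :> Type;
  mdim : nat;
  atlas : set (chart R mdim carrier);
  chart_at : carrier -> chart R mdim carrier }.

Arguments mdim {R} _.
Arguments atlas {R} _.
Arguments chart_at {R M} _ : rename.

Definition mopen (R : realType) (M : premanifold R) (A : set M) : Prop :=
  forall c, atlas M c -> open (cmap c @` (A `&` cdom c)).

Record is_manifold (R : realType) (M : premanifold R) : Prop := IsManifold {
  chart_at_atlas : forall p : M, atlas M (chart_at p);
  chart_at_dom : forall p : M, cdom (chart_at p) p;
  cmapK : forall c, atlas M c -> forall p, cdom c p -> cinv c (cmap c p) = p;
  cmap_open : forall c, atlas M c -> open (cmap c @` cdom c);
  overlap_open : forall c d, atlas M c -> atlas M d ->
    open (cmap c @` (cdom c `&` cdom d));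
  transition_smooth : forall c d, atlas M c -> atlas M d ->
    smooth_on (cmap c @` (cdom c `&` cdom d)) (cmap d \o cinv c);
  manifold_hausdorff : forall p q : M, p <> q ->
    exists A B : set M,
      [/\ mopen A, mopen B, A p, B q & A `&` B = set0];
  manifold_second_countable : exists b : nat -> set M,
    (forall k, mopen (b k)) /\
    (forall (A : set M) p, mopen A -> A p ->
       exists2 k, b k p & b k `<=` A) }.

Definition mcontinuous_at (R : realType) (M N : premanifold R) (f : M -> N)
  (p : M) : Prop :=
  forall B : set N, mopen B -> B (f p) ->
  exists A : set M, [/\ mopen A, A p & A `<=` f @^-1` B].

Definition mcvg (R : realType) (M : premanifold R) (u : nat -> M) (p : M) :
    Prop :=
  forall A : set M, mopen A -> A p ->
  exists k0, forall k, (k0 <= k)%N -> A (u k).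

Definition local_rep (R : realType) (M N : premanifold R) (f : M -> N)
  (p : M) : 'rV[R]_(mdim M) -> 'rV[R]_(mdim N) :=
  cmap (chart_at (f p)) \o f \o cinv (chart_at p).

Definition smooth_at (R : realType) (M N : premanifold R) (f : M -> N)
  (p : M) : Prop :=
  mcontinuous_at f p /\ smooth_near (cmap (chart_at p) p) (local_rep f p).

Definition smooth (R : realType) (M N : premanifold R) (f : M -> N) : Prop :=
  forall p, smooth_at f p.

Definition Tmap (R : realType) (M N : premanifold R) (f : M -> N) (p : M)
  (v : 'rV[R]_(mdim M)) : 'rV[R]_(mdim N) :=
  'd (local_rep f p) (cmap (chart_at p) p) v.

Definition smooth_fun (R : realType) (M : premanifold R) (K : M -> R) : Prop :=
  forall p, smooth_near (V := R^o) (cmap (chart_at p) p)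
                        (K \o cinv (chart_at p)).

Definition dfun (R : realType) (M : premanifold R) (K : M -> R) (p : M)
  (v : 'rV[R]_(mdim M)) : R :=
  'd (K \o cinv (chart_at p) : 'rV[R]_(mdim M) -> R^o) (cmap (chart_at p) p) v.

(* Coordinates in [c] of the tangent vector [v] at [p], and conversely. *)
Definition chart_of_vec (R : realType) (M : premanifold R)
  (c : chart R (mdim M) M) (p : M) (v : 'rV[R]_(mdim M)) : 'rV[R]_(mdim M) :=
  'd (cmap c \o cinv (chart_at p)) (cmap (chart_at p) p) v.

Definition vec_of_chart (R : realType) (M : premanifold R)
  (c : chart R (mdim M) M) (p : M) (w : 'rV[R]_(mdim M)) : 'rV[R]_(mdim M) :=
  'd (cmap (chart_at p) \o cinv c) (cmap c p) w.

Definition pairing (R : realType) (n : nat) (a v : 'rV[R]_n) : R :=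
  \sum_(i < n) a 0 i * v 0 i.

Definition basis_vec (R : realType) (n : nat) (i : 'I_n) : 'rV[R]_n :=
  delta_mx 0 i.

(* The covector at [p] has chart coordinates a(d/dx^i), where [a] is the
   functional on T_p M. *)
Definition chart_of_covec (R : realType) (M : premanifold R)
  (c : chart R (mdim M) M) (p : M) (a : 'rV[R]_(mdim M)) : 'rV[R]_(mdim M) :=
  \row_i pairing a (vec_of_chart c p (basis_vec R i)).

Definition covec_of_chart (R : realType) (M : premanifold R)
  (c : chart R (mdim M) M) (p : M) (b : 'rV[R]_(mdim M)) : 'rV[R]_(mdim M) :=
  \row_i pairing b (chart_of_vec c p (basis_vec R i)).

Definition immersion (R : realType) (M N : premanifold R) (f : M -> N) : Prop :=
  smooth f /\ forall p, injective (Tmap f p).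

Definition submersion (R : realType) (M N : premanifold R) (f : M -> N) :
    Prop :=
  smooth f /\ forall p w, exists v, Tmap f p v = w.

Definition regular_value (R : realType) (M N : premanifold R) (f : M -> N)
  (y : N) : Prop :=
  forall p, f p = y -> forall w, exists v, Tmap f p v = w.

Definition embedding (R : realType) (S M : premanifold R) (j : S -> M) : Prop :=
  [/\ immersion j, injective j &
      forall A : set S, mopen A ->
      exists2 B : set M, mopen B & j @` A = B `&` range j].

Definition submanifold (R : realType) (M : premanifold R) (A : set M) : Prop :=
  exists (S : premanifold R) (j : S -> M),
    [/\ is_manifold S, embedding j & range j = A].

(* Injectively immersed submanifolds N such that a map into N is smooth as soon
   as it is smooth as a map into the ambient manifold; this determines the
   manifold structure of N from its underlying set. *)
Definition initial_submanifold (R : realType) (N M : premanifold R)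
  (i : N -> M) : Prop :=
  [/\ immersion i, injective i &
      forall (S : premanifold R) (f : S -> N),
        is_manifold S -> smooth (i \o f) -> smooth f].

(* For a vector [a] tangent to the immersed submanifold [i : N -> M] at [i z],
   the vector of T_z N that represents it. *)
Definition tangent_lift (R : realType) (N M : premanifold R) (i : N -> M)
  (z : N) (a : 'rV[R]_(mdim M)) : 'rV[R]_(mdim N) :=
  xget 0 [set x | Tmap i z x = a].

Definition vspace_chart (R : realType) (n : nat) : chart R n 'rV[R]_n :=
  Chart setT id id.

Definition vspace (R : realType) (n : nat) : premanifold R :=
  @Premanifold R 'rV[R]_n n [set vspace_chart R n] (fun=> vspace_chart R n).

Definition prod_chart (R : realType) (m n : nat) (M N : Type)
  (c : chart R m M) (d : chart R n N) : chart R (m + n) (M * N) :=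
  Chart [set z | cdom c z.1 /\ cdom d z.2]
        (fun z => row_mx (cmap c z.1) (cmap d z.2))
        (fun x => (cinv c (lsubmx x), cinv d (rsubmx x))).

Definition mprod (R : realType) (M N : premanifold R) : premanifold R :=
  @Premanifold R (M * N)%type (mdim M + mdim N)
    [set e | exists c d, [/\ atlas M c, atlas N d & e = prod_chart c d]]
    (fun z => prod_chart (chart_at z.1) (chart_at z.2)).

Definition bilinear2 (R : realType) (n : nat) (b : 'rV[R]_n -> 'rV[R]_n -> R) :
    Prop :=
  (forall (a : R) u v w, b (a *: u + v) w = a * b u w + b v w) /\
  (forall (a : R) u v w, b w (a *: u + v) = a * b w u + b w v).

(* Component of the covariant 2-tensor [t] on the constant fields [v], [w] of
   the chart [c], as a function of the coordinates. *)
Definition tensor2_rep (R : realType) (M : premanifold R)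
  (t : M -> 'rV[R]_(mdim M) -> 'rV[R]_(mdim M) -> R)
  (c : chart R (mdim M) M) (v w x : 'rV[R]_(mdim M)) : R^o :=
  t (cinv c x) (vec_of_chart c (cinv c x) v) (vec_of_chart c (cinv c x) w).

Definition smooth_tensor2 (R : realType) (M : premanifold R)
  (t : M -> 'rV[R]_(mdim M) -> 'rV[R]_(mdim M) -> R) : Prop :=
  (forall p, bilinear2 (t p)) /\
  (forall p v w, smooth_near (cmap (chart_at p) p)
                             (tensor2_rep t (chart_at p) v w)).

Definition extd1 (R : realType) (M : premanifold R)
  (th : M -> 'rV[R]_(mdim M) -> R) (p : M) (v w : 'rV[R]_(mdim M)) : R :=
  let c := chart_at p in
  let rep (u x : 'rV[R]_(mdim M)) : R^o :=
    th (cinv c x) (vec_of_chart c (cinv c x) u) in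
  'D_v (rep w) (cmap c p) - 'D_w (rep v) (cmap c p).

Definition extd2 (R : realType) (M : premanifold R)
  (om : M -> 'rV[R]_(mdim M) -> 'rV[R]_(mdim M) -> R) (p : M)
  (u v w : 'rV[R]_(mdim M)) : R :=
  let c := chart_at p in
  'D_u (tensor2_rep om c v w) (cmap c p)
  - 'D_v (tensor2_rep om c u w) (cmap c p)
  + 'D_w (tensor2_rep om c u v) (cmap c p).

Definition vf_bracket (R : realType) (M : premanifold R)
  (X Y : M -> 'rV[R]_(mdim M)) (p : M) : 'rV[R]_(mdim M) :=
  let c := chart_at p in
  let rep (Z : M -> 'rV[R]_(mdim M)) (x : 'rV[R]_(mdim M)) :=
    chart_of_vec c (cinv c x) (Z (cinv c x)) in
  'D_(X p) (rep Y) (cmap c p) - 'D_(Y p) (rep X) (cmap c p).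

Record symplectic_form (R : realType) (M : premanifold R)
  (om : M -> 'rV[R]_(mdim M) -> 'rV[R]_(mdim M) -> R) : Prop := SymplecticForm {
  symplectic_smooth : smooth_tensor2 om;
  symplectic_alternating : forall p v, om p v v = 0;
  symplectic_closed : forall p u v w, extd2 om p u v w = 0;
  symplectic_nondegenerate : forall p v, (forall w, om p v w = 0) -> v = 0 }.

Definition symplectic_map (R : realType) (M N : premanifold R)
  (omM : M -> 'rV[R]_(mdim M) -> 'rV[R]_(mdim M) -> R)
  (omN : N -> 'rV[R]_(mdim N) -> 'rV[R]_(mdim N) -> R) (f : M -> N) : Prop :=
  smooth f /\
  forall p v w, omN (f p) (Tmap f p v) (Tmap f p w) = omM p v w.

(* Well defined when [om] is nondegenerate; the default 0 is then irrelevant. *)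
Definition hamvf (R : realType) (M : premanifold R)
  (om : M -> 'rV[R]_(mdim M) -> 'rV[R]_(mdim M) -> R) (K : M -> R) (p : M) :
    'rV[R]_(mdim M) :=
  xget 0 [set x | forall v, om p x v = dfun K p v].

Definition cot_chart (R : realType) (Q : premanifold R)
  (c : chart R (mdim Q) Q) :
    chart R (mdim Q + mdim Q) (Q * 'rV[R]_(mdim Q)) :=
  Chart [set z | cdom c z.1]
        (fun z => row_mx (cmap c z.1) (chart_of_covec c z.1 z.2))
        (fun x => let q := cinv c (lsubmx x) in
                  (q, covec_of_chart c q (rsubmx x))).

Definition cotangent (R : realType) (Q : premanifold R) : premanifold R :=
  @Premanifold R (Q * 'rV[R]_(mdim Q))%type (mdim Q + mdim Q)
    [set e | exists2 c, atlas Q c & e = cot_chart c]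
    (fun z => cot_chart (chart_at z.1)).

Definition cot_proj (R : realType) (Q : premanifold R) : cotangent Q -> Q :=
  fun z => z.1.
Arguments cot_proj {R} Q _.

Definition cot_theta (R : realType) (Q : premanifold R) (z : cotangent Q)
  (v : 'rV[R]_(mdim (cotangent Q))) : R :=
  pairing z.2 (Tmap (cot_proj Q) z v).
Arguments cot_theta {R} Q _ _.

Definition cot_omega (R : realType) (Q : premanifold R) (z : cotangent Q)
  (v w : 'rV[R]_(mdim (cotangent Q))) : R :=
  - extd1 (cot_theta Q) z v w.
Arguments cot_omega {R} Q _ _ _.

Definition one_form (R : realType) (Q : premanifold R) (ga : Q -> cotangent Q) :
    Prop :=
  smooth ga /\ forall q, cot_proj Q (ga q) = q.

Record pregroup (R : realType) := Pregroup {
  lg_mfd :> premanifold R;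
  lg_mul : lg_mfd -> lg_mfd -> lg_mfd;
  lg_one : lg_mfd;
  lg_inv : lg_mfd -> lg_mfd }.
Arguments lg_one {R}.

Record is_lie_group (R : realType) (G : pregroup R) : Prop := IsLieGroup {
  lie_manifold : is_manifold G;
  lg_mulA : forall a b c : G, lg_mul a (lg_mul b c) = lg_mul (lg_mul a b) c;
  lg_mul1 : forall a : G, lg_mul (lg_one G) a = a;
  lg_mulV : forall a : G, lg_mul (lg_inv a) a = lg_one G;
  lg_mul_smooth : smooth (fun ab : mprod G G => lg_mul ab.1 ab.2 : G);
  lg_inv_smooth : smooth (@lg_inv R G) }.

(* The Lie algebra is T_1 G with the bracket of left invariant fields. *)
Definition left_inv_vf (R : realType) (G : pregroup R) (xi : 'rV[R]_(mdim G))
  (g : G) : 'rV[R]_(mdim G) :=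
  Tmap (lg_mul g) (lg_one G) xi.

Definition lie_bracket (R : realType) (G : pregroup R)
  (xi eta : 'rV[R]_(mdim G)) : 'rV[R]_(mdim G) :=
  vf_bracket (left_inv_vf (G := G) xi) (left_inv_vf (G := G) eta) (lg_one G).

Definition Ad (R : realType) (G : pregroup R) (g : G) (xi : 'rV[R]_(mdim G)) :
    'rV[R]_(mdim G) :=
  Tmap (fun k : G => lg_mul (lg_mul g k) (lg_inv g) : G) (lg_one G) xi.

(* The coadjoint action g . nu = Ad*_{g^-1} nu on the dual of the Lie algebra,
   whose elements are given by coordinates in the dual basis. *)
Definition coAd (R : realType) (G : pregroup R) (g : G)
  (nu : vspace R (mdim G)) : vspace R (mdim G) :=
  \row_i pairing nu (Ad (lg_inv g) (basis_vec R i)).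

Definition coadjoint_orbit (R : realType) (G : pregroup R)
  (mu : vspace R (mdim G)) : set (vspace R (mdim G)) :=
  [set nu | exists g : G, nu = coAd g mu].

Record is_action (R : realType) (G : pregroup R) (M : premanifold R)
  (act : G -> M -> M) : Prop := IsAction {
  act1 : forall p, act (lg_one G) p = p;
  actM : forall g k p, act (lg_mul g k) p = act g (act k p);
  act_smooth : smooth (fun gp : mprod G M => act gp.1 gp.2 : M) }.

Definition free_action (R : realType) (G : pregroup R) (M : premanifold R)
  (act : G -> M -> M) : Prop :=
  forall g p, act g p = p -> g = lg_one G.

Definition proper_action (R : realType) (G : pregroup R) (M : premanifold R)
  (act : G -> M -> M) : Prop :=
  forall (g : nat -> G) (u : nat -> M) (p q : M),
    mcvg u p -> mcvg (fun k => act (g k) (u k)) q ->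
    exists (s : nat -> nat) (g0 : G),
      (forall k, (s k < s k.+1)%N) /\ mcvg (g \o s) g0.

(* xi_M(p) = d/dt exp(t xi) . p at t = 0, i.e. the image of xi under the
   tangent map of g |-> g . p. *)
Definition inf_gen (R : realType) (G : pregroup R) (M : premanifold R)
  (act : G -> M -> M) (xi : 'rV[R]_(mdim G)) (p : M) : 'rV[R]_(mdim M) :=
  Tmap (fun g : G => act g p : M) (lg_one G) xi.

Definition coad_gen (R : realType) (G : pregroup R) (xi : 'rV[R]_(mdim G))
  (nu : vspace R (mdim G)) : 'rV[R]_(mdim G) :=
  inf_gen (M := vspace R (mdim G)) (@coAd R G) xi nu.

(* Phi^{T*}_g = T* Phi_{g^-1}. *)
Definition cot_lift (R : realType) (G : pregroup R) (Q : premanifold R)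
  (act : G -> Q -> Q) (g : G) (z : cotangent Q) : cotangent Q :=
  (act g z.1,
   \row_i pairing z.2 (Tmap (act (lg_inv g)) (act g z.1) (basis_vec R i))).

Record equivariant_momentum_map (R : realType) (G : pregroup R)
  (P : premanifold R) (om : P -> 'rV[R]_(mdim P) -> 'rV[R]_(mdim P) -> R)
  (act : G -> P -> P) (J : P -> vspace R (mdim G)) : Prop :=
  EquivariantMomentumMap {
  momentum_smooth : smooth J;
  momentum_eq : forall xi z v,
    om z (inf_gen act xi z) v = dfun (fun y => pairing (J y) xi) z v;
  momentum_equivariant : forall g z, J (act g z) = coAd g (J z) }.

Definition invariant_fun (R : realType) (G : pregroup R) (M : premanifold R)
  (act : G -> M -> M) (K : M -> R) : Prop :=
  forall g p, K (act g p) = K p.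

Definition equivariant_map (R : realType) (G : pregroup R)
  (M N : premanifold R) (actM : G -> M -> M) (actN : G -> N -> N)
  (f : M -> N) : Prop :=
  forall g p, f (actM g p) = actN g (f p).

Definition invariant_set (R : realType) (G : pregroup R) (M : premanifold R)
  (act : G -> M -> M) (W : set M) : Prop :=
  forall g p, W (act g p) <-> W p.

Record hamiltonian_cotangent_action (R : realType) (G : pregroup R)
  (Q : premanifold R) (act : G -> Q -> Q)
  (J : cotangent Q -> vspace R (mdim G)) : Prop :=
  HamiltonianCotangentAction {
  hca_manifold : is_manifold Q;
  hca_group : is_lie_group G;
  hca_action : is_action act;
  hca_lift_action : is_action (cot_lift act);
  hca_lift_symplectic : forall g,
    symplectic_map (cot_omega Q) (cot_omega Q) (cot_lift act g);
  hca_lift_free : free_action (cot_lift act);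
  hca_lift_proper : proper_action (cot_lift act);
  hca_momentum : equivariant_momentum_map (cot_omega Q) (cot_lift act) J }.

Record fiber_bundle (R : realType) (E M : premanifold R) (pi : E -> M) : Prop :=
  FiberBundle {
  bundle_total : is_manifold E;
  bundle_base : is_manifold M;
  bundle_smooth : smooth pi;
  bundle_surj : forall x, exists a, pi a = x;
  bundle_trivial : exists2 S : premanifold R, is_manifold S &
    forall x0 : M, exists (A : set M) (t : E -> S) (s : mprod M S -> E),
      [/\ mopen A, A x0,
          forall a, A (pi a) -> smooth_at t a /\ s (pi a, t a) = a &
          forall x y, A x ->
            [/\ smooth_at s (x, y), pi (s (x, y)) = x & t (s (x, y)) = y]] }.

Definition fiber_preserving (E M : Type) (pi : E -> M) (F : E -> E) : Prop :=
  forall a, pi (F a) = pi a.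

Definition fiber_submanifold (R : realType) (E M : premanifold R)
  (pi : E -> M) (W : set E) : Prop :=
  submanifold W /\ forall x, submanifold (W `&` pi @^-1` [set x]).

Record rch_system (R : realType) (E M : premanifold R) (pi : E -> M)
  (om : E -> 'rV[R]_(mdim E) -> 'rV[R]_(mdim E) -> R) (H : E -> R)
  (F : E -> E) (W : set E) : Prop := RchSystem {
  rch_bundle : fiber_bundle pi;
  rch_symplectic : symplectic_form om;
  rch_hamiltonian : smooth_fun H;
  rch_force_smooth : smooth F;
  rch_force_fiber : fiber_preserving pi F;
  rch_control : fiber_submanifold pi W }.

Definition control_law (R : realType) (E M : premanifold R) (pi : E -> M)
  (W : set E) (u : E -> E) : Prop :=
  [/\ smooth u, fiber_preserving pi u & forall a, W (u a)].

Record riemannian_metric (R : realType) (M : premanifold R)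
  (g : M -> 'rV[R]_(mdim M) -> 'rV[R]_(mdim M) -> R) : Prop :=
  RiemannianMetric {
  metric_smooth : smooth_tensor2 g;
  metric_sym : forall p v w, g p v w = g p w v;
  metric_pos : forall p v, v != 0 -> 0 < g p v v }.

Definition pullback2 (R : realType) (S M : premanifold R) (j : S -> M)
  (g : M -> 'rV[R]_(mdim M) -> 'rV[R]_(mdim M) -> R) (p : S)
  (v w : 'rV[R]_(mdim S)) : R :=
  g (j p) (Tmap j p v) (Tmap j p w).

(* The V_a E component of [w] in T_a E = H_a E + V_a E, where V E = ker T pi
   and H E is its orthogonal complement. *)
Definition vert_part (R : realType) (E M : premanifold R) (pi : E -> M)
  (g : E -> 'rV[R]_(mdim E) -> 'rV[R]_(mdim E) -> R) (a : E)
  (w : 'rV[R]_(mdim E)) : 'rV[R]_(mdim E) :=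
  xget 0 [set v | Tmap pi a v = 0 /\
                  forall v', Tmap pi a v' = 0 -> g a (w - v) v' = 0].

(* Curves and fields along curves are considered on [0, 1]. *)
Definition smooth_curve (R : realType) (S : premanifold R) (c : R -> S) :
    Prop :=
  forall t, 0 <= t <= 1 ->
    (forall B : set S, mopen B -> B (c t) -> \forall s \near t, B (c s)) /\
    smooth_near (U := R^o) t (cmap (chart_at (c t)) \o c).

Definition velocity (R : realType) (S : premanifold R) (c : R -> S) (t : R) :
    'rV[R]_(mdim S) :=
  derive1 (cmap (chart_at (c t)) \o c) t.

Definition along_rep (R : realType) (S : premanifold R) (c : R -> S)
  (V : R -> 'rV[R]_(mdim S)) (k : chart R (mdim S) S) (s : R) :
    'rV[R]_(mdim S) :=
  chart_of_vec k (c s) (V s).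

(* Parallelism for the Levi-Civita connection of [g]: in the chart around c(t),
   g_kl (V'^l + Gamma^l_ij c'^i V^j) = 0 for all k, the Christoffel symbols of
   the first kind being (d_i g_jk + d_j g_ik - d_k g_ij) / 2. *)
Definition parallel_along (R : realType) (S : premanifold R)
  (g : S -> 'rV[R]_(mdim S) -> 'rV[R]_(mdim S) -> R) (c : R -> S)
  (V : R -> 'rV[R]_(mdim S)) : Prop :=
  forall t, 0 <= t <= 1 ->
    let k := chart_at (c t) in
    let x := cmap k (c t) in
    let c' := velocity c t in
    smooth_near (U := R^o) t (along_rep c V k) /\
    forall w : 'rV[R]_(mdim S),
      g (c t) (derive1 (along_rep c V k) t) w
      + 2^-1 * ('D_c' (tensor2_rep g k (V t) w) x
                + 'D_(V t) (tensor2_rep g k c' w) x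
                - 'D_w (tensor2_rep g k c' (V t)) x) = 0.

Definition geodesic (R : realType) (S : premanifold R)
  (g : S -> 'rV[R]_(mdim S) -> 'rV[R]_(mdim S) -> R) (c : R -> S) : Prop :=
  smooth_curve c /\ parallel_along g c (velocity c).

(* [v] is a value of vlift(F)X at [a], for a fiber-preserving [F]: the vertical
   part of TF(X(a)), parallel translated along a geodesic from F(a) to a in the
   fiber through [a], which carries the metric induced by [g].  This is a
   relation because such a geodesic need not be unique. *)
Definition is_vlift (R : realType) (E M : premanifold R) (pi : E -> M)
  (g : E -> 'rV[R]_(mdim E) -> 'rV[R]_(mdim E) -> R) (F : E -> E)
  (X : E -> 'rV[R]_(mdim E)) (a : E) (v : 'rV[R]_(mdim E)) : Prop :=
  exists (S : premanifold R) (j : S -> E) (c : R -> S)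
         (V : R -> 'rV[R]_(mdim S)),
    [/\ [/\ is_manifold S, embedding j & range j = pi @^-1` [set pi a]],
        [/\ geodesic (pullback2 j g) c, j (c 0) = F a & j (c 1) = a],
        parallel_along (pullback2 j g) c V,
        Tmap j (c 0) (V 0) = vert_part pi g (F a) (Tmap F a (X a)) &
        Tmap j (c 1) (V 1) = v].

Definition is_dynamical_vf (R : realType) (E M : premanifold R) (pi : E -> M)
  (g : E -> 'rV[R]_(mdim E) -> 'rV[R]_(mdim E) -> R)
  (om : E -> 'rV[R]_(mdim E) -> 'rV[R]_(mdim E) -> R) (H : E -> R)
  (F u : E -> E) (Y : E -> 'rV[R]_(mdim E)) : Prop :=
  forall a, exists v1 v2,
    [/\ is_vlift pi g F (hamvf om H) a v1,
        is_vlift pi g u (hamvf om H) a v2 &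
        Y a = hamvf om H a + v1 + v2].

(* On T*Q the fibers are vector spaces and the translation from F(a) to a is
   along a straight line.  A vertical vector at a point of T*_q Q has
   coordinates (0, b) in the chart induced by [chart_at q], and [b] is the
   corresponding element of T*_q Q itself; F(a) and a lie over the same q. *)
Definition cot_vlift (R : realType) (Q : premanifold R)
  (g : cotangent Q -> 'rV[R]_(mdim (cotangent Q)) ->
       'rV[R]_(mdim (cotangent Q)) -> R)
  (F : cotangent Q -> cotangent Q)
  (X : cotangent Q -> 'rV[R]_(mdim (cotangent Q))) (a : cotangent Q) :
    'rV[R]_(mdim (cotangent Q)) :=
  let w : 'rV[R]_(mdim Q + mdim Q) :=
    vert_part (cot_proj Q) g (F a) (Tmap F a (X a)) in
  row_mx 0 (rsubmx w).

Definition cot_dynamical_vf (R : realType) (Q : premanifold R)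
  (g : cotangent Q -> 'rV[R]_(mdim (cotangent Q)) ->
       'rV[R]_(mdim (cotangent Q)) -> R)
  (H : cotangent Q -> R) (F u : cotangent Q -> cotangent Q)
  (a : cotangent Q) : 'rV[R]_(mdim (cotangent Q)) :=
  hamvf (cot_omega Q) H a + cot_vlift g F (hamvf (cot_omega Q) H) a
  + cot_vlift g u (hamvf (cot_omega Q) H) a.

Definition orbit_level (R : realType) (G : pregroup R) (Q : premanifold R)
  (J : cotangent Q -> vspace R (mdim G)) (mu : vspace R (mdim G)) :
    set (cotangent Q) :=
  J @^-1` coadjoint_orbit mu.

Definition kks_form (R : realType) (G : pregroup R) (mu : vspace R (mdim G))
  (omp : vspace R (mdim G) -> 'rV[R]_(mdim G) -> 'rV[R]_(mdim G) -> R) :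
    Prop :=
  forall nu, coadjoint_orbit mu nu -> forall xi eta,
    omp nu (coad_gen xi nu) (coad_gen eta nu) =
    pairing nu (lie_bracket (G := G) xi eta).

(* [i : N -> T*Q] is J^-1(O_mu) with its inclusion, [pr : N -> B] is the
   projection onto J^-1(O_mu)/G, and [omO] is the reduced symplectic form.
   The tangent space of the orbit at nu consists of the vectors xi_{g*}(nu);
   [ored_tangent] says T(J^-1(O_mu)) = (TJ)^-1(T O_mu).  The manifold structure
   of B is the one that makes [pr] a submersion. *)
Record orbit_reduced_space (R : realType) (G : pregroup R) (Q : premanifold R)
  (act : G -> Q -> Q) (J : cotangent Q -> vspace R (mdim G))
  (mu : vspace R (mdim G)) (N B : premanifold R) (i : N -> cotangent Q)
  (pr : N -> B)
  (omp : vspace R (mdim G) -> 'rV[R]_(mdim G) -> 'rV[R]_(mdim G) -> R)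
  (omO : B -> 'rV[R]_(mdim B) -> 'rV[R]_(mdim B) -> R) : Prop :=
  OrbitReducedSpace {
  ored_level : is_manifold N;
  ored_initial : initial_submanifold i;
  ored_range : range i = orbit_level J mu;
  ored_tangent : forall z,
    range (Tmap i z) =
    [set a | exists xi, Tmap J (i z) a = coad_gen xi (J (i z))];
  ored_quotient : is_manifold B;
  ored_submersion : submersion pr;
  ored_surj : forall b, exists z, pr z = b;
  ored_fibers : forall z z',
    pr z = pr z' <-> exists g, i z' = cot_lift act g (i z);
  ored_kks : kks_form mu omp;
  ored_symplectic : symplectic_form omO;
  ored_form : forall z v w,
    pullback2 i (cot_omega Q) z v w =
    pullback2 pr omO z v w +
    omp (J (i z)) (Tmap (J \o i) z v) (Tmap (J \o i) z w) }.

Record regular_orbit_reducible_rch (R : realType) (G : pregroup R)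
  (Q : premanifold R) (act : G -> Q -> Q)
  (J : cotangent Q -> vspace R (mdim G)) (mu : vspace R (mdim G))
  (H : cotangent Q -> R) (F : cotangent Q -> cotangent Q)
  (W : set (cotangent Q))
  (N B M : premanifold R) (i : N -> cotangent Q) (pr : N -> B) (piB : B -> M)
  (omp : vspace R (mdim G) -> 'rV[R]_(mdim G) -> 'rV[R]_(mdim G) -> R)
  (omO : B -> 'rV[R]_(mdim B) -> 'rV[R]_(mdim B) -> R)
  (h : B -> R) (f : B -> B) (WO : set B) : Prop :=
  RegularOrbitReducibleRch {
  ror_action : hamiltonian_cotangent_action act J;
  ror_rch : rch_system (cot_proj Q) (cot_omega Q) H F W;
  ror_inv_H : invariant_fun (cot_lift act) H;
  ror_inv_F : equivariant_map (cot_lift act) (cot_lift act) F;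
  ror_inv_W : invariant_set (cot_lift act) W;
  ror_regular : regular_value J mu;
  ror_force : F @` orbit_level J mu `<=` orbit_level J mu;
  ror_control : W `&` orbit_level J mu !=set0;
  ror_reduced : orbit_reduced_space act J mu i pr omp omO;
  ror_reduced_rch : rch_system piB omO h f WO;
  ror_h : forall z, h (pr z) = H (i z);
  ror_f : forall z z', i z' = F (i z) -> f (pr z) = pr z';
  ror_WO : WO = [set pr z | z in i @^-1` W] }.

(* (X_h + vlift(f) + vlift(uO)) o pr = T pr o X o i; that the right-hand side
   makes sense includes that X is tangent to J^-1(O_mu). *)
Definition reduced_dynamics_related (R : realType) (P N B : premanifold R)
  (i : N -> P) (pr : N -> B) (X : P -> 'rV[R]_(mdim P))
  (Y : B -> 'rV[R]_(mdim B)) : Prop :=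
  forall z, Tmap i z (tangent_lift i z (X (i z))) = X (i z) /\
            Y (pr z) = Tmap pr z (tangent_lift i z (X (i z))).

(* [fN : S -> N] is [f : S -> P] viewed as a map into the subset [i : N -> P]. *)
Definition corestriction (S N P : Type) (i : N -> P) (f : S -> P)
  (fN : S -> N) : Prop := forall x, i (fN x) = f x.

(* Main.v *)
Require Import Defs.
From HB Require Import structures.
From mathcomp Require Import all_boot all_order all_algebra.
From mathcomp Require Import mathcomp_extra boolp classical_sets functions.
From mathcomp Require Import reals interval_inference topology normedtype landau derive.
(* The base points of the two equations agree, because lambda = gamma o pi_Q and
   i is injective, and the two sides of the first equation are, unconditionally,
   the two sides of the second one in the opposite order:
   - T lambda_bar (X(eps z)) = T gamma_bar (T pi_Q (X(eps z))) by the chain rule;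
   - T eps_bar (X_(H o eps)) = X_h o eps_bar.  Indeed eps is symplectic, so
     T eps maps X_(H o eps) to X_H o eps; by invariance of H o eps and H both
     fields lie in ker TJ, hence are tangent to J^-1(O_mu); and on ker TJ the
     term J^* omega^+ vanishes, so that T pr maps X_H to X_h.
   The smoothness of eps and gamma as maps into J^-1(O_mu) comes from the
   initial submanifold property, applied to eps o i and gamma. *)

Set Implicit Arguments.
Unset Strict Implicit.
Unset Printing Implicit Defensive.
Import Order.TTheory GRing.Theory Num.Theory.
Import numFieldNormedType.Exports.
Local Open Scope classical_set_scope.
Local Open Scope ring_scope.

(** * Germs, derivatives and the calculus of C^k maps *)

(** A first order expansion depends only on the germ at [x]. Since it characterizes the derivative,
    both the value of 'd and differentiability pass from [f] to [g]. *)
Lemma near_eq_diff_expansion (R : realType) (U V : normedModType R)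
    (f g : U -> V) (x : U) : {near x, f =1 g} -> differentiable f x ->
  g \o shift x = cst (g x) + 'd f x +o_ 0 id.
Proof.
move=> fg df; apply/eqaddoP => _/posnumP[e].
have /eqaddoP/(_ e%:num (gt0 e)) := diff_locally df.
have /nbhs0P := fg; apply: filter_app2; near=> y => /= fgy.
by rewrite -![(_ - _) y]/(_ y - _ y) /= [y + x]addrC fgy (nbhs_singleton fg).
Unshelve. all: by end_near. Qed.

Lemma near_eq_diff (R : realType) (U V : normedModType R) (f g : U -> V)
    (x : U) : {near x, f =1 g} -> differentiable f x -> 'd g x = 'd f x :> (U -> V).
Proof.
move=> fg df; apply: diff_unique; first exact: diff_continuous.
exact: near_eq_diff_expansion.
Qed.

Lemma near_eq_differentiable (R : realType) (U V : normedModType R)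
    (f g : U -> V) (x : U) : {near x, f =1 g} -> differentiable f x ->
  differentiable g x.
Proof.
move=> fg df; apply/diff_locallyP; rewrite (near_eq_diff fg df); split.
  exact: diff_continuous.
exact: near_eq_diff_expansion.
Qed.

Lemma near_open (T : topologicalType) (A : set T) (P : T -> Prop) x :
  open A -> A x -> (forall y, A y -> P y) -> \forall y \near x, P y.
Proof. by move=> oA Ax AP; apply: filterS AP _; exact: open_nbhs_nbhs. Qed.

(** On an open set, pointwise equality is equality of germs at every point, so it is inherited by
    all directional derivatives and the induction on [k] goes through. *)
Lemma Ck_congr (R : realType) (U V : normedModType R) (k : nat) (A : set U)
    (f g : U -> V) : open A -> (forall x, A x -> f x = g x) ->
  Ck k A f -> Ck k A g.
Proof.
move=> oA; elim: k f g => [|k IH] f g fg /=.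
  move=> fc x Ax; rewrite /prop_for /continuous_at -(fg _ Ax).
  apply: cvg_trans (fc x Ax); apply: near_eq_cvg.
  exact: near_open oA Ax fg.
move=> [df Df]; split.
  by move=> x Ax; apply: near_eq_differentiable (df x Ax); exact: near_open Ax fg.
move=> v; apply: IH (Df v) => x Ax.
by apply: near_eq_derive; exact: near_open Ax fg.
Qed.

Lemma Ck_subset (R : realType) (U V : normedModType R) (k : nat) (A B : set U)
    (f : U -> V) : A `<=` B -> Ck k B f -> Ck k A f.
Proof.
move=> AB; elim: k f => [|k IH] f /=; first by move=> fc x /AB /fc.
by move=> [df Df]; split=> [x /AB /df //|v]; apply: IH.
Qed.

Lemma CkW (R : realType) (U V : normedModType R) (k : nat) (A : set U)
    (f : U -> V) : Ck k.+1 A f -> Ck k A f.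
Proof.
elim: k f => [|k IH] f [df Df].
  by move=> x Ax; apply: differentiable_continuous; exact: df.
by split=> // v; apply: IH.
Qed.

Lemma Ck_cst (R : realType) (U V : normedModType R) (k : nat) (A : set U)
    (a : V) : Ck k A (cst a : U -> V).
Proof.
elim: k a => [|k IH] a /=; first by move=> x _; exact: cvg_cst.
split=> [x _|v]; first exact: differentiable_cst.
by rewrite (_ : 'D_v _ = cst 0) //; apply/funext => x; exact: derive_cst.
Qed.

Lemma CkD (R : realType) (U V : normedModType R) (k : nat) (A : set U)
    (f g : U -> V) : open A -> Ck k A f -> Ck k A g -> Ck k A (f + g).
Proof.
move=> oA; elim: k f g => [|k IH] f g /=.
  by move=> fc gc x Ax; apply: continuousD; [exact: fc|exact: gc].
move=> [df Df] [dg Dg]; split=> [x Ax|v].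
  by apply: differentiableD; [exact: df|exact: dg].
apply: Ck_congr (IH _ _ (Df v) (Dg v)) => // x Ax.
by rewrite deriveD //; apply: diff_derivable; [exact: df|exact: dg].
Qed.

Lemma Ck_sum (R : realType) (U V : normedModType R) (k n : nat) (A : set U)
    (f : 'I_n -> U -> V) : open A -> (forall j, Ck k A (f j)) ->
  Ck k A (\sum_(j < n) f j).
Proof.
move=> oA Cf; elim/big_ind: _ => //; first exact: Ck_cst.
by move=> g h; exact: CkD.
Qed.

Lemma scale_is_bilinear (R : realType) (V : normedModType R) :
  bilinear_for (GRing.Scale.Law.clone _ _ *:%R _)
    (GRing.Scale.Law.clone _ _ *:%R _) ( *:%R : R^o -> V -> V).
Proof.
split=> [w|a] c x y /=; first by rewrite scalerDl scalerA.
by rewrite scalerDr !scalerA mulrC.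
Qed.

(** The Leibniz rule: scaling is a continuous bilinear map, composed here with the differentiable
    pair [y |-> (a y, g y)]. *)
Lemma is_diff_scale (R : realType) (U V : normedModType R) (a : U -> R^o)
    (g : U -> V) (x : U) : differentiable a x -> differentiable g x ->
  is_diff x (fun y => a y *: g y)
            (fun v => a x *: 'd g x v + 'd a x v *: g x).
Proof.
move=> da dg.
pose bM := bilinear_isBilinear.Build _ _ _ _ _ _ _ (scale_is_bilinear V).
pose b : {bilinear R^o -> V -> V} := HB.pack ( *:%R : R^o -> V -> V) bM.
have bc : continuous (fun p : R^o * V => b p.1 p.2) by exact: scale_continuous.
pose p y := (a y, g y).
have dp : differentiable p x by exact: differentiable_pair.
have -> : (fun y => a y *: g y) = (fun q : R^o * V => b q.1 q.2) \o p by [].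
have db := differentiable_bilin (p x) bc.
apply: DiffDef; first exact: differentiable_comp.
by rewrite diff_comp // diff_bilin // diff_pair.
Qed.

Lemma CkZ (R : realType) (U V : normedModType R) (k : nat) (A : set U)
    (a : U -> R^o) (g : U -> V) : open A -> Ck k A a -> Ck k A g ->
  Ck k A (fun x => a x *: g x).
Proof.
move=> oA; elim: k a g => [|k IH] a g Ca Cg.
  by move=> x Ax; apply: cvgZ; [exact: Ca|exact: Cg].
have [da Da] := Ca; have [dg Dg] := Cg.
split=> [x Ax|v].
  by have [] := is_diff_scale (da x Ax) (dg x Ax).
(* D_v (a g) = a D_v g + (D_v a) g, where the undifferentiated factors are lowered to C^k by
   [CkW]. *)
apply: Ck_congr (CkD oA (IH _ _ (CkW Ca) (Dg v)) (IH _ _ (Da v) (CkW Cg))) => //.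
move=> x Ax; have [ds sE] := is_diff_scale (da x Ax) (dg x Ax).
rewrite deriveE // sE -!deriveE //; [exact: da|exact: dg].
Qed.

Lemma Ck_coord (R : realType) (U : normedModType R) (n k : nat) (A : set U)
    (f : U -> 'rV[R]_n) (j : 'I_n) : open A -> Ck k A f ->
  Ck k A (fun x => f x 0 j : R^o).
Proof.
move=> oA; elim: k f => [|k IH] f.
  by move=> fc x Ax; apply: (continuous_comp (g := fun M : 'rV[R]_n => M 0 j));
    [exact: fc|exact: coord_continuous].
move=> [df Df]; split=> [x Ax|v].
  by apply: (differentiable_comp (g := fun M : 'rV[R]_n => M 0 j : R^o));
    [exact: df|exact: differentiable_coord].
apply: Ck_congr (IH _ (Df v)) => // x Ax.
by rewrite derive_mx ?mxE //; apply: diff_derivable; exact: df.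
Qed.

(* The induction runs on [D_v (g o f) = sum_j (D_v f)_j D_(e_j) g o f]; the
   expansion over the basis turns it into sums, products and compositions of
   C^k maps. *)
Lemma Ck_comp (R : realType) (U V : normedModType R) (n k : nat) (A : set U)
    (B : set 'rV[R]_n) (f : U -> 'rV[R]_n) (g : 'rV[R]_n -> V) :
  open A -> f @` A `<=` B -> Ck k A f -> Ck k B g -> Ck k A (g \o f).
Proof.
move=> oA fAB; have fB x : A x -> B (f x) by move=> Ax; apply: fAB; exists x.
elim: k f g fAB fB => [|k IH] f g fAB fB Cf Cg.
  move=> x Ax; have cf : {for x, continuous f} by exact: Cf.
  have cg : {for f x, continuous g} by exact: Cg (fB _ Ax).
  exact: continuous_comp cf cg.
have [df Df] := Cf; have [dg Dg] := Cg.
split=> [x Ax|v].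
  by apply: differentiable_comp; [exact: df|exact: dg (fB _ Ax)].
have CD (j : 'I_n) : Ck k A (fun x => ('D_v f x) 0 j *: ('D_(delta_mx 0 j) g \o f) x).
  apply: CkZ => //; first exact: (Ck_coord j oA (Df v)).
  exact: IH fAB fB (CkW Cf) (Dg _).
apply: Ck_congr (Ck_sum oA CD) => // x Ax.
have dfx := df x Ax; have dgx := dg _ (fB x Ax).
rewrite deriveE; last exact: differentiable_comp.
rewrite diff_comp //= -(deriveE _ dfx) [in RHS](row_sum_delta ('D_v f x)).
rewrite linear_sum fct_sumE.
by apply: eq_bigr => j _; rewrite linearZ /= -deriveE.
Qed.

(** The map [h] is kept apart from [g \o f] because the local representative of a composite equals
    the composite of the representatives only near the base point. *)
Lemma smooth_near_comp (R : realType) (U V : normedModType R) (n : nat)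
    (f : U -> 'rV[R]_n) (g : 'rV[R]_n -> V) (h : U -> V) (x : U) :
  smooth_near x f -> smooth_near (f x) g -> {near x, g \o f =1 h} ->
  smooth_near x h.
Proof.
move=> [A [oA Ax Cf]] [B [oB Bfx Cg]]; rewrite /prop_near1 nbhsE /= => -[D [oD Dx] Dh].
pose E := A `&` D `&` f @^-1` B.
have oE : open E.
  rewrite openE => y [[Ay Dy] By]; rewrite /interior.
  apply: filterI; first by apply: filterI; exact: open_nbhs_nbhs.
  have fc : {for y, continuous f} by exact: Cf 0%N y Ay.
  by apply: fc; exact: open_nbhs_nbhs.
exists E; split=> // k.
apply: (@Ck_congr _ _ _ _ _ (g \o f)) => //.
  by move=> y [[_ /Dh]].
apply: (@Ck_comp _ _ _ _ _ _ B) (Cg k) => //.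
  by move=> _ [y [_ By] <-].
by apply: Ck_subset (Cf k) => y [[]].
Qed.

Lemma smooth_near_differentiable (R : realType) (U V : normedModType R)
    (x : U) (f : U -> V) : smooth_near x f -> differentiable f x.
Proof. by move=> [A [_ Ax /(_ 1%N) [df _]]]; exact: df. Qed.

(** * Linear maps on row vectors and the pairing *)

(** Expansion over the standard basis writes [f] as a sum of coordinate functions times fixed
    vectors. *)
Lemma rV_linear_differentiable (R : realType) (n : nat) (V : normedModType R)
    (f : {linear 'rV[R]_n -> V}) (x : 'rV[R]_n) : differentiable f x.
Proof.
have -> : (f : _ -> _) = \sum_(j < n) (fun y : 'rV[R]_n => y 0 j *: f (delta_mx 0 j)).
  apply/funext => y; rewrite fct_sumE {1}(row_sum_delta y) linear_sum.
  by apply: eq_bigr => j _; rewrite linearZ.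
apply: differentiable_sum => j.
by apply: differentiableZl; exact: differentiable_coord.
Qed.

Lemma rV_linear_diff (R : realType) (n : nat) (V : normedModType R)
    (f : {linear 'rV[R]_n -> V}) (x : 'rV[R]_n) : 'd f x = f :> (_ -> _).
Proof.
apply: diff_lin => y; apply: differentiable_continuous.
exact: rV_linear_differentiable.
Qed.

Lemma pairing_linear_l (R : realType) (n : nat) (xi : 'rV[R]_n) :
  linear ((fun a => pairing a xi) : 'rV[R]_n -> R^o).
Proof.
move=> k a b; rewrite /pairing scaler_sumr -big_split /=.
by apply: eq_bigr => j _; rewrite !mxE mulrDl -mulrA.
Qed.

Lemma pairing_eq0 (R : realType) (n : nat) (a : 'rV[R]_n) :
  (forall xi, pairing a xi = 0) -> a = 0.
Proof.
move=> a0; apply/rowP => j; rewrite mxE -[RHS](a0 (delta_mx 0 j)) /pairing.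
rewrite (bigD1 j) //= mxE !eqxx mulr1 big1 ?addr0 // => k kj.
by rewrite mxE (negbTE kj) mulr0.
Qed.

(** * Differentiable maps of manifolds and the chain rule *)

(* Pointwise differentiability of maps of manifolds, in the form used by the
   chain rule: [f] need only map a neighbourhood of [p] into the chart at [f p]. *)
Definition mdifferentiable (R : realType) (M N : premanifold R) (f : M -> N)
    (p : M) : Prop :=
  differentiable (local_rep f p) (cmap (chart_at p) p) /\
  \forall x \near cmap (chart_at p) p,
    cdom (chart_at (f p)) (f (cinv (chart_at p) x)).

Definition fdifferentiable (R : realType) (M : premanifold R) (K : M -> R)
    (p : M) : Prop :=
  differentiable (K \o cinv (chart_at p) : 'rV[R]_(mdim M) -> R^o)
    (cmap (chart_at p) p).

Lemma chart_atK (R : realType) (M : premanifold R) (p : M) :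
  is_manifold M -> cinv (chart_at p) (cmap (chart_at p) p) = p.
Proof.
by move=> mM; apply: cmapK (chart_at_dom mM p) => //; exact: chart_at_atlas.
Qed.

Lemma mopen_cdom (R : realType) (M : premanifold R) (p : M) :
  is_manifold M -> mopen (cdom (chart_at p)).
Proof.
move=> mM c Mc; rewrite setIC.
exact: overlap_open mM _ _ Mc (chart_at_atlas mM p).
Qed.

Lemma mopen_chart_image (R : realType) (M : premanifold R) (A : set M) (p : M) :
  is_manifold M -> mopen A -> A p ->
  \forall x \near cmap (chart_at p) p,
    exists q, [/\ A q, cdom (chart_at p) q & x = cmap (chart_at p) q].
Proof.
move=> mM oA Ap; have Mc := chart_at_atlas mM p.
apply: (near_open (oA _ Mc)) => [|_ [q [Aq cq] <-]]; last by exists q.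
by exists p => //; split=> //; exact: chart_at_dom.
Qed.

Lemma mopen_chart (R : realType) (M : premanifold R) (A : set M) (p : M) :
  is_manifold M -> mopen A -> A p ->
  \forall x \near cmap (chart_at p) p, A (cinv (chart_at p) x).
Proof.
move=> mM oA Ap; apply: filterS (mopen_chart_image mM oA Ap).
move=> _ [q [Aq cq ->]].
by rewrite (cmapK mM) //; exact: chart_at_atlas.
Qed.

(** The target enters only through its chart at [f p], so that the lemma applies directly to
    momentum maps, whose values lie in [vspace]. *)
Lemma smooth_at_mdifferentiable (R : realType) (M N : premanifold R)
    (f : M -> N) (p : M) : is_manifold M -> mopen (cdom (chart_at (f p))) ->
  cdom (chart_at (f p)) (f p) -> smooth_at f p -> mdifferentiable f p.
Proof.
move=> mM oN fpN [fc fs]; split; first exact: smooth_near_differentiable.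
have [A [oA Ap AB]] := fc _ oN fpN.
by apply: filterS (mopen_chart mM oA Ap) => x /AB.
Qed.

Lemma smooth_mdifferentiable (R : realType) (M N : premanifold R)
    (f : M -> N) (p : M) : is_manifold M -> is_manifold N -> smooth f ->
  mdifferentiable f p.
Proof.
move=> mM mN fs; apply: smooth_at_mdifferentiable (fs p) => //.
  exact: mopen_cdom.
exact: chart_at_dom.
Qed.

Lemma local_rep_at (R : realType) (M N : premanifold R) (f : M -> N) (p : M) :
  is_manifold M ->
  local_rep f p (cmap (chart_at p) p) = cmap (chart_at (f p)) (f p).
Proof. by move=> mM; rewrite /local_rep /= chart_atK. Qed.

(** The chart condition in [mdifferentiable] serves here: near [p], going through the chart at [f p]
    and back loses nothing. *)
Lemma local_rep_cinv (R : realType) (M N : premanifold R) (f : M -> N) (p : M) :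
  is_manifold N -> mdifferentiable f p ->
  \forall x \near cmap (chart_at p) p,
    cinv (chart_at (f p)) (local_rep f p x) = f (cinv (chart_at p) x).
Proof.
move=> mN [_]; apply: filterS => x fx.
by rewrite /local_rep /= (cmapK mN) //; exact: chart_at_atlas.
Qed.

Lemma mdifferentiable_comp (R : realType) (M N P : premanifold R) (f : M -> N)
    (g : N -> P) (p : M) : is_manifold M -> is_manifold N ->
  mdifferentiable f p -> mdifferentiable g (f p) ->
  mdifferentiable (g \o f) p /\
  Tmap (g \o f) p = Tmap g (f p) \o Tmap f p.
Proof.
move=> mM mN mf mg; have [df fdom] := mf; have [dg gdom] := mg.
have fE := local_rep_at f p mM.
have gfE : {near cmap (chart_at p) p,
    local_rep g (f p) \o local_rep f p =1 local_rep (g \o f) p}.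
  by apply: filterS (local_rep_cinv mN mf) => x; rewrite /local_rep /= => ->.
have dg' : differentiable (local_rep g (f p)) (local_rep f p (cmap (chart_at p) p)).
  by rewrite fE.
have dgf := differentiable_comp df dg'.
split; last first.
  apply/funext => v; rewrite /Tmap /=.
  have := congr1 (@^~ v) (near_eq_diff gfE dgf) => /= ->.
  have := congr1 (@^~ v) (diff_comp df dg') => /= ->.
  by rewrite fE.
split; first exact: near_eq_differentiable gfE dgf.
(* Continuity of the representative of [f] pulls the chart condition of [g] back to a neighbourhood
   of [p]. *)
have := differentiable_continuous df; rewrite /prop_for /continuous_at fE.
move=> /(_ _ gdom); apply: filterS2 (local_rep_cinv mN mf) => x /= fx.
by rewrite /= fx.
Qed.

Lemma Tmap_comp (R : realType) (M N P : premanifold R) (f : M -> N)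
    (g : N -> P) (p : M) v : is_manifold M -> is_manifold N ->
  mdifferentiable f p -> mdifferentiable g (f p) ->
  Tmap (g \o f) p v = Tmap g (f p) (Tmap f p v).
Proof.
by move=> mM mN mf mg; have [_ ->] := mdifferentiable_comp mM mN mf mg.
Qed.

Lemma dfun_comp (R : realType) (M N : premanifold R) (f : M -> N)
    (K : N -> R) (p : M) : is_manifold M -> is_manifold N ->
  mdifferentiable f p -> fdifferentiable K (f p) ->
  fdifferentiable (K \o f) p /\
  dfun (K \o f) p = dfun K (f p) \o Tmap f p.
Proof.
move=> mM mN mf dK; have [df _] := mf; have fE := local_rep_at f p mM.
have KfE : {near cmap (chart_at p) p,
    (K \o cinv (chart_at (f p)) : _ -> R^o) \o local_rep f p =1
    K \o f \o cinv (chart_at p)}.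
  by apply: filterS (local_rep_cinv mN mf) => x /= ->.
have dK' : differentiable (K \o cinv (chart_at (f p)) : _ -> R^o)
    (local_rep f p (cmap (chart_at p) p)) by rewrite fE.
have dKf := differentiable_comp df dK'.
split; first exact: near_eq_differentiable KfE dKf.
apply/funext => v; rewrite /dfun /=.
have := congr1 (@^~ v) (near_eq_diff KfE dKf) => /= ->.
have := congr1 (@^~ v) (diff_comp df dK') => /= ->.
by rewrite fE.
Qed.

Lemma smooth_comp (R : realType) (M N P : premanifold R) (f : M -> N)
    (g : N -> P) : is_manifold M -> is_manifold N ->
  smooth f -> smooth g -> smooth (g \o f).
Proof.
move=> mM mN fs gs p; have [fc fp] := fs p; have [gc gp] := gs (f p).
split.
  move=> B oB Bgf; have [A [oA Af AB]] := gc B oB Bgf.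
  have [A' [oA' A'p A'A]] := fc A oA Af.
  by exists A'; split=> // x /A'A /AB.
rewrite -local_rep_at // in gp; apply: smooth_near_comp fp gp _.
apply: filterS (local_rep_cinv mN (smooth_mdifferentiable p mM mN fs)) => x /= fx.
by move: fx; rewrite /local_rep /= => ->.
Qed.

Lemma dfun_cst (R : realType) (M : premanifold R) (a : R) (p : M) v :
  dfun (cst a : M -> R) p v = 0.
Proof.
rewrite /dfun (_ : _ \o _ = cst (a : R^o)) //.
by rewrite diff_cst.
Qed.

(** * Nondegenerate forms and Hamiltonian vector fields *)

Lemma unitmx_of_trivial_kernel (R : realType) (n : nat) (A : 'M[R]_n) :
  (forall x : 'rV[R]_n, x *m A = 0 -> x = 0) -> A \in unitmx.
Proof.
move=> A0; rewrite -row_free_unit -kermx_eq0; apply/eqP/row_matrixP => j.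
rewrite row0; apply: A0; rewrite -row_mul mulmx_ker.
by apply/rowP => k; rewrite !mxE.
Qed.

Lemma injective_rV_linear_surjective (R : realType) (n : nat)
    (f : {linear 'rV[R]_n -> 'rV[R]_n}) : (forall x, f x = 0 -> x = 0) ->
  forall w, exists v, f v = w.
Proof.
move=> f0 w; have fA : lin1_mx f \in unitmx.
  by apply: unitmx_of_trivial_kernel => x; rewrite mul_rV_lin1; exact: f0.
by exists (w *m invmx (lin1_mx f)); rewrite -mul_rV_lin1 mulmxKV.
Qed.

(** By nondegeneracy the Gram matrix [B] has trivial left kernel, hence is invertible; [x] solves x
    B = (l(e_k))_k. *)
Lemma nondegenerate_represents (R : realType) (n : nat)
    (b : 'rV[R]_n -> 'rV[R]_n -> R) (l : {linear 'rV[R]_n -> R^o}) :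
  bilinear2 b -> (forall v, (forall w, b v w = 0) -> v = 0) ->
  exists x, forall v, b x v = l v.
Proof.
move=> [bl br] b0.
pose B := \matrix_(j, k) b (delta_mx 0 j) (delta_mx 0 k).
have lin_l w : linear ((fun u => b u w) : 'rV[R]_n -> R^o).
  by move=> a u v; exact: bl.
have lin_r u : linear ((b u) : 'rV[R]_n -> R^o).
  by move=> a v w; exact: br.
pose Ll w : {linear 'rV[R]_n -> R^o} :=
  HB.pack ((fun u => b u w) : 'rV[R]_n -> R^o)
    (GRing.isLinear.Build _ _ _ _ _ (lin_l w)).
pose Lr u : {linear 'rV[R]_n -> R^o} :=
  HB.pack (b u : 'rV[R]_n -> R^o)
    (GRing.isLinear.Build _ _ _ _ _ (lin_r u)).
have bE x k : b x (delta_mx 0 k) = (x *m B) 0 k.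
  rewrite -[LHS]/(Ll _ x) {1}(row_sum_delta x) linear_sum mxE.
  by apply: eq_bigr => j _; rewrite linearZ mxE.
have B_unit : B \in unitmx.
  apply: unitmx_of_trivial_kernel => x xB0; apply: b0 => w.
  rewrite -[LHS]/(Lr _ w) (row_sum_delta w) linear_sum big1 // => k _.
  by rewrite linearZ /= bE xB0 mxE scaler0.
exists ((\row_k l (delta_mx 0 k)) *m invmx B) => v.
rewrite -[LHS]/(Lr _ v) (row_sum_delta v) !linear_sum; apply: eq_bigr => k _.
by rewrite !linearZ /= bE mulmxKV // mxE.
Qed.

Lemma symplectic_skew (R : realType) (M : premanifold R)
    (om : M -> 'rV[R]_(mdim M) -> 'rV[R]_(mdim M) -> R) (p : M) v w :
  symplectic_form om -> om p v w = - om p w v.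
Proof.
move=> [[/(_ p) [bl br] _] alt _ _].
have addl a b c : om p (a + b) c = om p a c + om p b c.
  by rewrite -[a]scale1r bl mul1r scale1r.
have addr a b c : om p c (a + b) = om p c a + om p c b.
  by rewrite -[a]scale1r br mul1r scale1r.
have := alt p (v + w); rewrite addl !addr !alt add0r addr0.
by move/eqP; rewrite addr_eq0 => /eqP.
Qed.

Lemma symplectic_inj (R : realType) (M : premanifold R)
    (om : M -> 'rV[R]_(mdim M) -> 'rV[R]_(mdim M) -> R) (p : M) x y :
  symplectic_form om -> (forall v, om p x v = om p y v) -> x = y.
Proof.
move=> [[/(_ p) [bl _] _] _ _ nd] xy; apply/eqP; rewrite -subr_eq0; apply/eqP.
apply: (nd p) => w; rewrite -[y]scale1r -scaleNr addrC bl xy.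
by rewrite mulN1r addNr.
Qed.

(** Nondegeneracy supplies a representing vector, so [xget] does not fall back on its default 0. *)
Lemma hamvfP (R : realType) (M : premanifold R)
    (om : M -> 'rV[R]_(mdim M) -> 'rV[R]_(mdim M) -> R) (K : M -> R) (p : M) v :
  symplectic_form om -> om p (hamvf om K p) v = dfun K p v.
Proof.
move=> [[bil _] _ _ nd]; move: v; rewrite /hamvf.
apply: (@xgetPex _ 0 [set x | forall v, om p x v = dfun K p v]).
exact: (nondegenerate_represents _ (bil p) (nd p)).
Qed.

Lemma hamvf_unique (R : realType) (M : premanifold R)
    (om : M -> 'rV[R]_(mdim M) -> 'rV[R]_(mdim M) -> R) (K : M -> R) (p : M) x :
  symplectic_form om -> (forall v, om p x v = dfun K p v) -> x = hamvf om K p.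
Proof.
by move=> som xK; apply: (symplectic_inj (p := p) som) => v; rewrite xK hamvfP.
Qed.

(** Preserving a nondegenerate form makes T phi injective, hence onto since source and target have
    equal dimension. It then suffices to test against vectors T phi v, where both sides equal d(K o
    phi)(v). *)
Lemma symplectic_map_hamvf (R : realType) (M : premanifold R)
    (om : M -> 'rV[R]_(mdim M) -> 'rV[R]_(mdim M) -> R) (K : M -> R)
    (phi : M -> M) (p : M) : is_manifold M -> symplectic_form om ->
  symplectic_map om om phi -> fdifferentiable K (phi p) ->
  Tmap phi p (hamvf om (K \o phi) p) = hamvf om K (phi p).
Proof.
move=> mM som [phis phio] dK.
have mphi := smooth_mdifferentiable p mM mM phis.
have [_ dKphi] := dfun_comp mM mM mphi dK.
have Tphi0 x : Tmap phi p x = 0 -> x = 0.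
  move=> Tx0; apply: (symplectic_nondegenerate som (p := p)) => w.
  rewrite -phio Tx0; have [[bil _] _ _ _] := som; have [bl _] := bil (phi p).
  (* Linearity with scalar -1 at the vectors 0 and 0 gives om(0, w) = 0. *)
  by have := bl (-1) 0 0 (Tmap phi p w); rewrite scaler0 addr0 mulN1r addNr.
apply: hamvf_unique => // w.
(* The tangent map is given as the differential it unfolds to, which carries the linear
   structure. *)
have [v <-] := injective_rV_linear_surjective
  (f := 'd (local_rep phi p) (cmap (chart_at p) p)) Tphi0 w.
rewrite -/(Tmap phi p v) phio hamvfP //.
by rewrite dKphi.
Qed.

(** * Orbit maps and conservation of momentum *)

Lemma row_mx0_linear (R : realType) (m n : nat) :
  linear (fun x : 'rV[R]_m => row_mx x (0 : 'rV[R]_n)).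
Proof. by move=> a x y; rewrite scale_row_mx add_row_mx scaler0 addr0. Qed.

Lemma row_mx_differentiable (R : realType) (m n : nat) (y : 'rV[R]_n)
    (x : 'rV[R]_m) : differentiable (fun x => row_mx x y) x.
Proof.
pose L : {linear 'rV[R]_m -> 'rV[R]_(m + n)} :=
  HB.pack (fun x : 'rV[R]_m => row_mx x (0 : 'rV[R]_n))
    (GRing.isLinear.Build _ _ _ _ _ (@row_mx0_linear R m n)).
have -> : (fun x : 'rV[R]_m => row_mx x y) = (L : _ -> _) + cst (row_mx 0 y).
  by apply/funext => u; rewrite fctE /cst /= add_row_mx addr0 add0r.
apply: differentiableD; first exact: rV_linear_differentiable.
exact: differentiable_cst.
Qed.

(** The orbit map is the smooth action map restricted to the slice through [p], which in a product
    chart is the affine map [x |-> row_mx x y]. *)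
Lemma orbit_map_mdifferentiable (R : realType) (G : pregroup R)
    (M : premanifold R) (act : G -> M -> M) (p : M) : is_manifold G ->
  is_manifold M -> is_action act ->
  mdifferentiable (fun g : G => act g p : M) (lg_one G).
Proof.
move=> mG mM [a1 _ as_].
pose e := lg_one G; pose A := fun gp : mprod G M => act gp.1 gp.2 : M.
have [Ac /smooth_near_differentiable dA] := as_ (e, p).
pose y := cmap (chart_at p) p.
have yK : cinv (chart_at p) y = p by exact: chart_atK.
split.
  have -> : local_rep (fun g => act g p : M) e =
      local_rep A (e, p) \o (fun x => row_mx x y).
    by apply/funext => x; rewrite /local_rep /= row_mxKl row_mxKr yK.
  exact: differentiable_comp (row_mx_differentiable y _) dA.
have [D [oD Dep DA]] := Ac _ (mopen_cdom mM) (chart_at_dom mM _).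
have /oD oDC : atlas (mprod G M) (prod_chart (chart_at e) (chart_at p)).
  by exists (chart_at e), (chart_at p); split=> //; exact: chart_at_atlas.
(* [S] is the image of [D] in the product chart. It is a neighbourhood of the base point and is
   pulled back along the slice. *)
pose S (w : 'rV[R]_(mdim G + mdim M)) := exists g q, [/\ D (g, q),
  cdom (chart_at e) g, cdom (chart_at p) q &
  w = row_mx (cmap (chart_at e) g) (cmap (chart_at p) q)].
have Dx : \forall w \near row_mx (cmap (chart_at e) e) y, S w.
  apply: (near_open oDC) => [|_ [[g q] [Dgq [/= cg cq]] <-]]; last first.
    by exists g, q; split.
  by exists (e, p) => //; split=> //; split; exact: chart_at_dom.
have rc := differentiable_continuous
  (row_mx_differentiable y (cmap (chart_at e) e)).
have Sx : \forall x \near cmap (chart_at e) e, S (row_mx x y) by exact: rc _ Dx.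
apply: filterS Sx => x [g [q [Dgq cg cq /eq_row_mx [-> qy]]]].
rewrite (cmapK mG (chart_at_atlas mG e) cg).
(* On the slice the second coordinate is constantly [y], and the chart is injective on its
   domain. *)
have pq : p = q by rewrite -yK qy (cmapK mM (chart_at_atlas mM p) cq).
by rewrite -pq in Dgq; exact: DA Dgq.
Qed.

Lemma mopen_vspace_setT (R : realType) (n : nat) :
  mopen (setT : set (vspace R n)).
Proof.
move=> _ ->; rewrite setTI (_ : _ @` _ = setT); first exact: openT.
by apply/seteqP; split=> // x _; exists x.
Qed.

(** Noether's theorem: the pairing of TJ(X_K) with xi is d<J, xi>(X_K) = om(xi_P, X_K) = - dK(xi_P),
    which vanishes because K is constant on orbits. *)
Lemma invariant_hamvf_momentum (R : realType) (G : pregroup R)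
    (P : premanifold R) (om : P -> 'rV[R]_(mdim P) -> 'rV[R]_(mdim P) -> R)
    (act : G -> P -> P) (J : P -> vspace R (mdim G)) (K : P -> R) (z : P) :
  is_manifold G -> is_manifold P -> symplectic_form om -> is_action act ->
  equivariant_momentum_map om act J -> invariant_fun act K ->
  fdifferentiable K z -> Tmap J z (hamvf om K z) = 0.
Proof.
move=> mG mP som aact [Js Jeq _] Kinv dK; have [a1 _ _] := aact.
have [dJ _] : mdifferentiable J z.
  by apply: smooth_at_mdifferentiable (Js z) => //; exact: mopen_vspace_setT.
apply: pairing_eq0 => xi.
pose L : {linear 'rV[R]_(mdim G) -> R^o} :=
  HB.pack ((fun a => pairing a xi) : 'rV[R]_(mdim G) -> R^o)
    (GRing.isLinear.Build _ _ _ _ _ (pairing_linear_l xi)).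
have -> : pairing (Tmap J z (hamvf om K z)) xi =
    dfun (fun y => pairing (J y) xi) z (hamvf om K z).
  rewrite /dfun.
  have -> : ((fun y => pairing (J y) xi) \o cinv (chart_at z) : _ -> R^o) =
    L \o local_rep J z by [].
  by rewrite diff_comp ?rV_linear_diff //; exact: rV_linear_differentiable.
rewrite -Jeq (symplectic_skew _ _ _ som) hamvfP // /inf_gen.
have mo : mdifferentiable (fun g : G => act g z : P) (lg_one G).
  exact: orbit_map_mdifferentiable.
have dK' : fdifferentiable K (act (lg_one G) z) by rewrite a1.
have [_ ] := dfun_comp mG mP mo dK'.
rewrite (_ : K \o _ = cst (K z)); last by apply/funext => g; exact: Kinv.
rewrite a1 => /(congr1 (fun F => F xi)) /=; rewrite dfun_cst => <-.
by rewrite oppr0.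
Qed.

(** * Tangent vectors of the level set and the reduced Hamiltonian field *)

Lemma tangent_liftK (R : realType) (N M : premanifold R) (i : N -> M) (z : N)
    (a : 'rV[R]_(mdim M)) : range (Tmap i z) a ->
  Tmap i z (tangent_lift i z a) = a.
Proof.
by move=> [x _ xa]; apply: (@xgetPex _ 0 [set x | Tmap i z x = a]); exists x.
Qed.

(** Seeing zero as the generator of xi = 0 makes vectors of ker TJ tangent to J^-1(O_mu), and gives
    the zero vector the form in which [kks_form] evaluates it. *)
Lemma coad_gen0 (R : realType) (G : pregroup R) (nu : vspace R (mdim G)) :
  coad_gen (0 : 'rV[R]_(mdim G)) nu = 0.
Proof. by rewrite /coad_gen /inf_gen /Tmap linear0. Qed.

Lemma lie_bracket0l (R : realType) (G : pregroup R) (eta : 'rV[R]_(mdim G)) :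
  lie_bracket (G := G) 0 eta = 0.
Proof.
have X0 : left_inv_vf (G := G) 0 = fun=> 0.
  by apply/funext => g; rewrite /left_inv_vf /Tmap linear0.
rewrite /lie_bracket /vf_bracket X0 derive0 sub0r.
rewrite (_ : (fun x => _) = cst 0); first by rewrite derive_cst oppr0.
by apply/funext => x; rewrite /chart_of_vec linear0.
Qed.

Lemma orbit_level_tangent (R : realType) (G : pregroup R) (Q : premanifold R)
    (act : G -> Q -> Q) (J : cotangent Q -> vspace R (mdim G))
    (mu : vspace R (mdim G)) (N B : premanifold R) (i : N -> cotangent Q)
    (pr : N -> B) omp omO (z : N) (a : 'rV[R]_(mdim (cotangent Q))) :
  orbit_reduced_space act J mu i pr omp omO ->
  Tmap J (i z) a = 0 -> range (Tmap i z) a.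
Proof.
move=> ors a0; rewrite (ored_tangent ors) /=.
by exists 0; rewrite coad_gen0.
Qed.

(** Since [pr] is a submersion, testing against T pr v suffices. There omO(T pr x, T pr v) is
    om(X_H, T i v) up to the orbit term, and om(X_H, T i v) = dH(T i v) = dh(T pr v) because h o pr
    = H o i. *)
Lemma reduced_hamvf (R : realType) (G : pregroup R) (Q : premanifold R)
    (act : G -> Q -> Q) (J : cotangent Q -> vspace R (mdim G))
    (mu : vspace R (mdim G)) (N B : premanifold R) (i : N -> cotangent Q)
    (pr : N -> B) omp omO (H : cotangent Q -> R) (h : B -> R) (z : N) x :
  is_manifold (cotangent Q) -> symplectic_form (cot_omega Q) -> smooth J ->
  orbit_reduced_space act J mu i pr omp omO ->
  fdifferentiable H (i z) -> fdifferentiable h (pr z) ->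
  (forall z, h (pr z) = H (i z)) ->
  Tmap i z x = hamvf (cot_omega Q) H (i z) ->
  Tmap J (i z) (hamvf (cot_omega Q) H (i z)) = 0 ->
  Tmap pr z x = hamvf omO h (pr z).
Proof.
move=> mP som Js ors dH dh hH xH JH.
have mN := ored_level ors; have mB := ored_quotient ors.
have [[is_ _] _ _] := ored_initial ors.
have [prs prsub] := ored_submersion ors.
have mi := smooth_mdifferentiable z mN mP is_.
have mpr := smooth_mdifferentiable z mN mB prs.
apply: hamvf_unique => [|w]; first exact: ored_symplectic ors.
have [v <-] := prsub z w.
have [_ dhpr] := dfun_comp mN mB mpr dh.
have [_ dHi] := dfun_comp mN mP mi dH.
have hE : h \o pr = H \o i by apply/funext => y; exact: hH.
have -> : dfun h (pr z) (Tmap pr z v) = dfun H (i z) (Tmap i z v).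
  by rewrite -[LHS]/((_ \o _) v) -dhpr hE dHi.
rewrite -(hamvfP _ _ _ som) -xH -[RHS]/(pullback2 i _ z x v) (ored_form ors).
(* The inserted 0 is matched with the orbit term, which remains to be shown to vanish. *)
rewrite /pullback2 -[LHS]addr0; congr (_ + _).
have mJ : mdifferentiable J (i z).
  by apply: smooth_at_mdifferentiable (Js _) => //; exact: mopen_vspace_setT.
have TJi u : Tmap (J \o i) z u = Tmap J (i z) (Tmap i z u).
  exact: Tmap_comp.
have [eta etaE] : exists eta, Tmap J (i z) (Tmap i z v) = coad_gen eta (J (i z)).
  have : range (Tmap i z) (Tmap i z v) by exists v.
  by rewrite (ored_tangent ors).
(* The first argument TJ(X_H) = 0 is the generator of 0, so the orbit term becomes the pairing of
   J(i z) with [0, eta] = 0. *)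
rewrite !TJi xH JH etaE -(coad_gen0 (J (i z))) (ored_kks ors).
  by rewrite lie_bracket0l /pairing big1 // => k _; rewrite mxE mulr0.
have : range i (i z) by exists z.
by rewrite (ored_range ors).
Qed.

(** * Comparison of the two Hamilton-Jacobi equations *)

Theorem theorem5p3 (R : realType) (G : pregroup R) (Q : premanifold R)
  (act : G -> Q -> Q) (J : cotangent Q -> vspace R (mdim G))
  (mu : vspace R (mdim G))
  (H : cotangent Q -> R) (F : cotangent Q -> cotangent Q)
  (W : set (cotangent Q))
  (N B M : premanifold R) (i : N -> cotangent Q) (pr : N -> B) (piB : B -> M)
  (omp : vspace R (mdim G) -> 'rV[R]_(mdim G) -> 'rV[R]_(mdim G) -> R)
  (omO : B -> 'rV[R]_(mdim B) -> 'rV[R]_(mdim B) -> R)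
  (h : B -> R) (f : B -> B) (WO : set B)
  (Hsys : regular_orbit_reducible_rch act J mu H F W i pr piB omp omO h f WO)
  (gE : cotangent Q -> 'rV[R]_(mdim (cotangent Q)) ->
        'rV[R]_(mdim (cotangent Q)) -> R)
  (HgE : riemannian_metric gE)
  (gB : B -> 'rV[R]_(mdim B) -> 'rV[R]_(mdim B) -> R)
  (HgB : riemannian_metric gB)
  (u : cotangent Q -> cotangent Q) (Hu : control_law (cot_proj Q) W u)
  (uO : B -> B) (HuO : control_law piB WO uO)
  (Y : B -> 'rV[R]_(mdim B)) (HY : is_dynamical_vf piB gB omO h f uO Y)
  (HXY : reduced_dynamics_related i pr (cot_dynamical_vf gE H F u) Y)
  (gamma : Q -> cotangent Q) (Hgamma : one_form gamma)
  (Hgamma_mu : range gamma `<=` J @^-1` [set mu])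
  (Hgamma_inv : equivariant_map act (cot_lift act) gamma)
  (eps : cotangent Q -> cotangent Q)
  (Heps : symplectic_map (cot_omega Q) (cot_omega Q) eps)
  (Heps_inv : equivariant_map (cot_lift act) (cot_lift act) eps)
  (Heps_level : eps @` orbit_level J mu `<=` orbit_level J mu)
  (gammaN : Q -> N) (HgammaN : corestriction i gamma gammaN)
  (lambdaN : N -> N)
  (HlambdaN : corestriction i ((gamma \o cot_proj Q) \o i) lambdaN)
  (epsN : N -> N) (HepsN : corestriction i (eps \o i) epsN) :
  let X := cot_dynamical_vf gE H F u in
  let X_eps := fun z : cotangent Q =>
    Tmap (cot_proj Q) (eps z) (X (eps z)) in
  let gamma_bar : Q -> B := pr \o gammaN in
  let lambda_bar : N -> B := pr \o lambdaN in
  let eps_bar : N -> B := pr \o epsN in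
  (forall z : N,
     (eps_bar z,
      Tmap eps_bar z
        (tangent_lift i z (hamvf (cot_omega Q) (H \o eps) (i z)))) =
     (lambda_bar (epsN z),
      Tmap lambda_bar (epsN z)
        (tangent_lift i (epsN z) (X (eps (i z))))))
  <->
  (forall z : N,
     (gamma_bar (cot_proj Q (eps (i z))),
      Tmap gamma_bar (cot_proj Q (eps (i z))) (X_eps (i z))) =
     (eps_bar z, hamvf omO h (eps_bar z))).
Proof.
move=> X X_eps gamma_bar lambda_bar eps_bar.
have bun := rch_bundle (ror_rch Hsys).
have mP := bundle_total bun; have mQ := bundle_base bun.
have pis := bundle_smooth bun.
have som := rch_symplectic (ror_rch Hsys).
have ors := ror_reduced Hsys.
have mN := ored_level ors; have mB := ored_quotient ors.
have [[is_ i_imm] i_inj i_initial] := ored_initial ors.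
have [prs _] := ored_submersion ors.
have hca := ror_action Hsys; have mom := hca_momentum hca.
have [phis _] := Heps.
have dH z : fdifferentiable H z.
  exact: smooth_near_differentiable (rch_hamiltonian (ror_rch Hsys) z).
have dh b : fdifferentiable h b.
  exact: smooth_near_differentiable (rch_hamiltonian (ror_reduced_rch Hsys) b).
have noether K z : invariant_fun (cot_lift act) K -> fdifferentiable K z ->
    Tmap J z (hamvf (cot_omega Q) K z) = 0.
  apply: (invariant_hamvf_momentum _ mP som (hca_lift_action hca) mom).
  exact: lie_manifold (hca_group hca).
have epsNs : smooth epsN.
  apply: (i_initial _ _ mN); rewrite (_ : i \o epsN = eps \o i).
    exact: (smooth_comp mN mP is_ phis).
  exact/funext.
have gammaNs : smooth gammaN.
  apply: (i_initial _ _ mQ); rewrite (_ : i \o gammaN = gamma); first by case: Hgamma.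
  exact/funext.
have lambdaNE : lambdaN = gammaN \o cot_proj Q \o i.
  by apply/funext => z; apply: i_inj; rewrite HlambdaN /= HgammaN.
have base z : lambda_bar (epsN z) = gamma_bar (cot_proj Q (eps (i z))).
  by rewrite /lambda_bar /gamma_bar lambdaNE /= HepsN.
have lambda_barE z : Tmap lambda_bar (epsN z)
      (tangent_lift i (epsN z) (X (eps (i z)))) =
    Tmap gamma_bar (cot_proj Q (eps (i z))) (X_eps (i z)).
  (* The relation with the reduced dynamics includes tangency of X to the level set, so the lift is
     a genuine preimage. *)
  have XK : Tmap i (epsN z) (tangent_lift i (epsN z) (X (eps (i z)))) =
      X (eps (i z)).
    by have [+ _] := HXY (epsN z); rewrite HepsN.
  have mi := smooth_mdifferentiable (epsN z) mN mP is_.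
  have mpi := smooth_mdifferentiable (i (epsN z)) mP mQ pis.
  have mgamma := smooth_mdifferentiable (cot_proj Q (i (epsN z))) mQ mB
    (smooth_comp mQ mN gammaNs prs).
  have mgpi := (mdifferentiable_comp mP mQ mpi mgamma).1.
  rewrite /lambda_bar lambdaNE.
  (* Regrouped so that the chain rule passes through T*Q, where T i turns the lift back into X. *)
  rewrite -[pr \o _]/((gamma_bar \o cot_proj Q) \o i).
  rewrite (Tmap_comp _ mN mP mi mgpi) (Tmap_comp _ mP mQ mpi mgamma) XK.
  by rewrite HepsN.
have eps_barE z : Tmap eps_bar z
      (tangent_lift i z (hamvf (cot_omega Q) (H \o eps) (i z))) =
    hamvf omO h (eps_bar z).
  set x := tangent_lift _ _ _.
  have meps := smooth_mdifferentiable (i z) mP mP phis.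
  have mi w := smooth_mdifferentiable w mN mP is_.
  have mepsN := smooth_mdifferentiable z mN mN epsNs.
  have xK : Tmap i z x = hamvf (cot_omega Q) (H \o eps) (i z).
    apply: tangent_liftK; apply: (orbit_level_tangent ors); apply: noether.
      by move=> g p; rewrite /= Heps_inv (ror_inv_H Hsys).
    by have [] := dfun_comp mP mP meps (dH (eps (i z))).
  rewrite (Tmap_comp _ mN mN mepsN (smooth_mdifferentiable _ mN mB prs)).
  (* Applied at [epsN z] to the vector T epsN x: from i o epsN = eps o i follows T i (T epsN x) = T
     eps (X_(H o eps)) = X_H at eps(i z). *)
  apply: (reduced_hamvf mP som (momentum_smooth mom) ors (dH _) (dh _)).
  - exact: ror_h Hsys.
  - rewrite -(Tmap_comp _ mN mN mepsN (mi _)).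
    rewrite (_ : i \o epsN = eps \o i); last exact/funext.
    rewrite (Tmap_comp _ mN mP (mi _) meps) xK HepsN.
    by apply: symplectic_map_hamvf.
  - by apply: noether => //; exact: ror_inv_H Hsys.
(* After these rewritings both equations are the same equality of pairs, read in opposite
   directions. *)
by split=> E z; have := E z; rewrite base lambda_barE eps_barE => ->.
Qed.
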